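(* For any finite simple connected $3$-regular graph $G$, $2\leq \mathrm{fgndi}_{\sum}(G)\leq 3$.
   Context: All graphs are finite, undirected, simple and connected. For a graph $G$ and an integer $k\ge 1$, a non-proper total $k$-coloring is an arbitrary map $f: V(G)\cup E(G)\rightarrow \{1,2,\dots,k\}$. Its weight function is $$\phi(x)=f(x)+\sum_{e\ni x}f(e)+\sum_{y\in N(x)}f(y)\quad (x\in V(G)),$$ where the first sum is over the edges $e$ incident with $x$ and $N(x)=\{y\in V(G): xy\in E(G)\}$. The coloring $f$ is called a neighbor full sum distinguishing (NFSD) total $k$-coloring if $\phi(x)\neq\phi(y)$ for every edge $xy\in E(G)$. The neighbor full sum distinguishing total chromatic number $\mathrm{fgndi}_{\sum}(G)$ is the smallest $k$ for which $G$ has an NFSD total $k$-coloring. *)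

(* Defs.v *)
From HB Require Import structures.
From mathcomp Require Import all_boot.

Set Implicit Arguments.
Unset Strict Implicit.
Unset Printing Implicit Defensive.

(* Finite simple graphs. *)
Record sgraph := SGraph {
  vertex :> finType;
  adj : rel vertex;
  adj_sym : symmetric adj;
  adj_irr : irreflexive adj
}.

Definition nbhd (G : sgraph) (x : G) : {set G} := [set y | adj x y].

Definition edges (G : sgraph) : {set {set G}} :=
  [set A : {set G} | [exists x, exists y, adj x y && (A == [set x; y])]].

Definition edge (G : sgraph) : finType := {A : {set G} | A \in edges G}.

(* The graph without vertices does not count as connected. *)
Definition connected (G : sgraph) : Prop :=
  0 < #|G| /\ forall x y : G, connect (@adj G) x y.

Definition regular (d : nat) (G : sgraph) : Prop :=
  forall x : G, #|nbhd x| = d.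

(* V(G) and E(G) are combined as a disjoint sum; colors are the naturals
   from 1 to k. *)
Definition total_coloring (G : sgraph) (k : nat) (f : G + edge G -> nat) :
  Prop := forall z, 1 <= f z <= k.

Definition weight (G : sgraph) (f : G + edge G -> nat) (x : G) : nat :=
  f (inl x) + \sum_(a : edge G | x \in val a) f (inr a)
  + \sum_(y in nbhd x) f (inl y).

Definition nfsd_coloring (G : sgraph) (k : nat) (f : G + edge G -> nat) :
  Prop :=
  total_coloring k f /\ forall x y : G, adj x y -> weight f x <> weight f y.

(* [is_fgndi G n] says that the invariant is defined for G and equals n.  It is
   a relation because some graphs (such as K_2) have no NFSD total
   coloring, whatever the number of colors. *)
Definition is_fgndi (G : sgraph) (n : nat) : Prop :=
  [/\ 1 <= n,
      exists f : G + edge G -> nat, nfsd_coloring n f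
    & forall k, 1 <= k ->
        (exists f : G + edge G -> nat, nfsd_coloring k f) -> n <= k].

(* Main.v *)
Require Import Defs.
From mathcomp Require Import all_boot.
From mathcomp Require Import zify.
From Stdlib Require Import Classical.

(** Only a 3-coloring has to be constructed: constant colorings give all vertices
    of a regular graph the same weight, so one color never suffices.

    Fix a vertex [v].  Since [G] is connected, its vertices can be listed from
    [v] outwards so that each other vertex [w] has an earlier neighbor [p w].  Go
    through the list backwards.  When [w] is reached, at most two neighbors of
    [w] have been treated, [p w] not being one of them, and the three possible
    labels of the edge from [w] to [p w] give [phi w] the three residues modulo
    3; so one of them makes [phi w] differ modulo 3 from the weights of all
    treated neighbors, and the only other weight it changes is that of the
    untreated [p w].  In the end the weights of adjacent vertices other than [v]
    differ modulo 3, whatever the vertex labels and the labels of the edges not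
    of the form [w, p w] were at the start ([greedy_residues]).

    This freedom is spent on making [phi v] larger than the weight of each
    neighbor.  Vertices of [N[v]] get label 3, all others label 1, edges
    inside [N(v)] get label 1, and neighbors [w] of [v] have [p w = v].  If [u]
    is a neighbor of [v], then each neighbor [a <> v] of [u] contributes at most
    4 to [phi u] together with its edge to [u]: it lies in [N(v)] and the
    edge has label 1, or it has label 1 itself.  Comparing with [phi v], one gets
    [phi u < phi v] as soon as the two other edges at [v] have label sum at
    least 3, that is, as soon as at most one edge at [v] has label 1
    ([center_dominates]).  If two of them have label 1, rotate the labels of all
    three edges at [v] by 1 -> 2 -> 3 -> 1 and lower the label of [v] from 3 to
    2: the weights of the neighbors of [v] are unchanged modulo 3, and at
    most one edge at [v] has label 1 afterwards. *)

Set Implicit Arguments.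
Unset Strict Implicit.
Unset Printing Implicit Defensive.

(** * Labelings of vertices and edges *)

(** Edge labels are carried by all sets of vertices, so that the label of the
    edge [xy] is simply [L [set x; y]]. *)
Definition label_weight (G : sgraph) (g : G -> nat) (L : {set G} -> nat)
    (x : G) : nat :=
  g x + \sum_(y in nbhd x) (L [set x; y] + g y).

Definition labels3 (T : Type) (L : T -> nat) : Prop := forall z, 1 <= L z <= 3.

Definition residues_differ (G : sgraph) (g : G -> nat) (L : {set G} -> nat)
    (T : {set G}) : Prop :=
  forall x y, x \in T -> y \in T -> adj x y ->
    label_weight g L x <> label_weight g L y %[mod 3].

Definition coloring_of (G : sgraph) (g : G -> nat) (L : {set G} -> nat)
    (z : G + edge G) : nat :=
  match z with inl x => g x | inr a => L (val a) end.

Lemma adj_neq (G : sgraph) (x y : G) : adj x y -> x != y.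
Proof. by apply: contraTneq => ->; rewrite adj_irr. Qed.

Lemma eq_pairP (T : finType) (x y z t : T) : [set x; y] = [set z; t] ->
  (x = z /\ y = t) \/ (x = t /\ y = z).
Proof.
move=> E.
have /set2P [xz|xt] : x \in [set z; t] by rewrite -E set21.
  have /set2P [yz|] : y \in [set z; t] by rewrite -E set22.
    have /set2P [] : t \in [set x; y] by rewrite E set22.
      by move=> tx; left; rewrite yz tx xz.
    by left.
  by left.
have /set2P [] : z \in [set x; y] by rewrite E set21.
  have /set2P [] : y \in [set z; t] by rewrite -E set22.
    by right.
  by move=> yt zx; right; rewrite yt zx xt.
by right.
Qed.

Lemma sum_incident_edges (G : sgraph) (L : {set G} -> nat) (x : G) :
  \sum_(a : edge G | x \in val a) L (val a)
    = \sum_(y in nbhd x) L [set x; y].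
Proof.
have inj : {in nbhd x &, injective (fun y => [set x; y])}.
  by move=> y z _ _ /eq_pairP [[]|[-> ->]].
rewrite -(big_imset L inj) /=.
rewrite [RHS](eq_bigl (fun A => (A \in edges G) && (x \in A))); last first.
  move=> A; apply/imsetP/andP => [[y]|[]].
    rewrite inE => xy ->; split; last by rewrite !inE eqxx.
    rewrite inE; apply/existsP; exists x; apply/existsP; exists y.
    by rewrite xy eqxx.
  rewrite inE => /existsP [a /existsP [b /andP [ab /eqP ->]]].
  rewrite !inE => /orP [] /eqP ->; first by exists b; rewrite ?inE.
  by exists a; rewrite ?inE 1?adj_sym // setUC.
by rewrite (big_sub_cond (mem (edges G)) (fun A : {set G} => x \in A) L).
Qed.

Lemma weight_coloring_of (G : sgraph) (g : G -> nat) (L : {set G} -> nat)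
    (x : G) : weight (coloring_of g L) x = label_weight g L x.
Proof.
by rewrite /weight /label_weight big_split /= addnA -sum_incident_edges.
Qed.

Lemma card_nbhdD1 (G : sgraph) (x y : G) :
  regular 3 G -> adj x y -> #|nbhd x :\ y| = 2.
Proof.
by move=> reg xy; have := cardsD1 y (nbhd x); rewrite reg inE xy => -[].
Qed.

Lemma label_weightD1 (G : sgraph) (g : G -> nat) (L : {set G} -> nat)
    (x y : G) : adj x y ->
  label_weight g L x = g x + L [set x; y] + g y
    + \sum_(z in nbhd x :\ y) (L [set x; z] + g z).
Proof.
move=> xy; rewrite /label_weight (big_setD1 y) ?inE //=.
by rewrite !addnA.
Qed.

(** * The greedy choice of edge labels *)

Lemma connected_grow_ind (G : sgraph) (v : G) (P : {set G} -> Prop) :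
  connected G -> P [set v] ->
  (forall (S : {set G}) w p, v \in S -> w \notin S -> p \in S -> adj w p ->
     P S -> P (w |: S)) ->
  P setT.
Proof.
move=> [_ conn] P1 PS.
have grow n : forall S : {set G}, v \in S -> P S -> #|~: S| <= n -> P setT.
  elim: n => [|n IHn] S vS PS'.
    rewrite leqn0 cards_eq0 => /eqP/(congr1 (@setC _)).
    by rewrite setCK setC0 => <-.
  move=> leSn.
  case: (boolP [exists w, exists p, [&& w \notin S, p \in S & adj w p]]).
    move=> /existsP [w /existsP [p /and3P [wS pS wp]]].
    apply: (IHn (w |: S)); first by rewrite inE vS orbT.
      exact: PS wp PS'.
    have := cardsD1 w (~: S); rewrite inE wS add1n => E.
    by rewrite setCU setIC -setDE -ltnS -E.
  move=> noedge.
  suff -> : setT = S by [].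
  have clS : closed (@adj G) (mem S).
    move=> x y xy /=; apply/idP/idP => [xS|yS]; apply: contraR noedge => nS.
      apply/existsP; exists y; apply/existsP; exists x.
      by rewrite nS adj_sym xy xS.
    by apply/existsP; exists x; apply/existsP; exists y; rewrite nS xy yS.
  apply/setP => x; rewrite inE.
  by have := closed_connect clS (conn v x); rewrite /= vS.
by apply: (grow _ [set v]); rewrite ?set11.
Qed.

Lemma exists_label_avoiding (c : nat) (r : seq nat) : size r <= 2 ->
  exists2 t, 1 <= t <= 3 & forall b, b \in r -> c + t <> b %[mod 3].
Proof.
case: r => [|a [|b []]] //= _; first by exists 1.
  have [t Ht Ha] : exists2 t, 1 <= t <= 3 & (c + t) %% 3 <> a %% 3.
    case: (eqVneq ((c + 1) %% 3) (a %% 3)) => [E|/eqP E]; last by exists 1.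
    by exists 2 => //; lia.
  by exists t => // b; rewrite inE => /eqP ->.
have [t Ht [Ha Hb]] : exists2 t, 1 <= t <= 3 &
    (c + t) %% 3 <> a %% 3 /\ (c + t) %% 3 <> b %% 3.
  have : (c + 1) %% 3 <> a %% 3 /\ (c + 1) %% 3 <> b %% 3 \/
         (c + 2) %% 3 <> a %% 3 /\ (c + 2) %% 3 <> b %% 3 \/
         (c + 3) %% 3 <> a %% 3 /\ (c + 3) %% 3 <> b %% 3 by lia.
  by case=> [H|[H|H]]; [exists 1|exists 2|exists 3].
by exists t => // d; rewrite !inE => /orP [] /eqP ->.
Qed.

(** Relabeling the edge [wp] changes no weight in [T], as
    neither endpoint lies in [T], and [w] has only two neighbors apart
    from [p] whose residues must be avoided. *)
Lemma extend_residues (G : sgraph) (g : G -> nat) (L : {set G} -> nat)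
    (T : {set G}) (w p : G) :
  regular 3 G -> adj w p -> w \notin T -> p \notin T ->
  labels3 L -> residues_differ g L T ->
  exists L', [/\ labels3 L', forall A, A != [set w; p] -> L' A = L A
                & residues_differ g L' (w |: T)].
Proof.
move=> reg wp wT pT L3 Ldiff.
pose c := g w + g p + \sum_(z in nbhd w :\ p) (L [set w; z] + g z).
have [|t t3 tP] := @exists_label_avoiding c
    [seq label_weight g L z | z <- enum (nbhd w :\ p)].
  by rewrite size_map -cardE card_nbhdD1.
pose L' A := if A == [set w; p] then t else L A.
have weight_w : label_weight g L' w = c + t.
  rewrite (label_weightD1 _ _ wp) {1}/L' eqxx /c.
  rewrite [in LHS](eq_bigr (fun z => L [set w; z] + g z)); first by lia.
  move=> z; rewrite !inE => /andP [zp _]; rewrite /L' ifF //.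
  by apply/negP => /eqP/eq_pairP [[_ E]|[E1 E2]]; move: zp;
    rewrite ?E ?E2 -?E1 ?eqxx.
have weight_T z : z \in T -> label_weight g L' z = label_weight g L z.
  move=> zT; congr (_ + _); apply: eq_bigr => y _; rewrite /L' ifF //.
  by apply/negP => /eqP/eq_pairP [[E _]|[E _]]; move: wT pT; rewrite -E zT.
have w_diff z : z \in T -> adj w z ->
    label_weight g L' w <> label_weight g L' z %[mod 3].
  move=> zT wz; rewrite weight_w weight_T //; apply: tP.
  apply/mapP; exists z => //; rewrite mem_enum !inE wz andbT.
  by apply: contraNneq pT => <-.
exists L'; split.
- by move=> A; rewrite /L'; case: ifP.
- by move=> A /negbTE nA; rewrite /L' nA.
move=> x y /setU1P [->|xT] /setU1P [->|yT] xy.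
- by rewrite adj_irr in xy.
- exact: w_diff.
- by apply/nesym/w_diff; rewrite // adj_sym.
- by rewrite !weight_T //; apply: Ldiff.
Qed.

(** Vertices are treated from the far end of the growth of [G] from [v], which
    in the induction means: given suitable labels on the complement of [S], the
    vertices of [S] can be treated too.  The last vertex [w] of [S] uses
    its edge to [v] if there is one, so edges inside [nbhd v] keep their
    labels. *)
Lemma greedy_residues (G : sgraph) (v : G) (g : G -> nat)
    (L : {set G} -> nat) :
  connected G -> regular 3 G -> labels3 L ->
  exists L', [/\ labels3 L', forall A : {set G}, A \subset nbhd v -> L' A = L A
                & residues_differ g L' (~: [set v])].
Proof.
move=> conn reg.
suff: forall M, labels3 M -> residues_differ g M (~: [set: G]) ->
    exists L', [/\ labels3 L', forall A : {set G}, A \subset nbhd v -> L' A = M A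
                  & residues_differ g L' (~: [set v])].
  by move=> H L3; apply: H => // x y; rewrite setCT inE.
apply: (@connected_grow_ind G v (fun S => forall M, labels3 M ->
    residues_differ g M (~: S) ->
    exists L', [/\ labels3 L', forall A : {set G}, A \subset nbhd v -> L' A = M A
                  & residues_differ g L' (~: [set v])])) => //.
  by move=> M M3 Mdiff; exists M.
move=> S w p vS wS pS wp IH M M3 Mdiff.
pose q := if adj v w then v else p.
have wq : adj w q by rewrite /q; case: ifP => // vw; rewrite adj_sym.
have qS : q \in S by rewrite /q; case: ifP.
have wq_out : ~~ ([set w; q] \subset nbhd v).
  apply/negP => /subsetP H.
  have /= := H w; rewrite !inE eqxx => /(_ isT) vw.
  by have := H q; rewrite /q vw !inE eqxx orbT adj_irr => /(_ isT).
have [||M' [M'3 M'E M'diff]] := extend_residues reg wq _ _ M3 Mdiff.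
- by rewrite !inE eqxx.
- by rewrite !inE qS orbT.
have [|L' [L'3 L'E L'diff]] := IH M' M'3.
  move=> x y xS yS; apply: M'diff.
    by rewrite !inE in xS *; case: eqP.
  by rewrite !inE in yS *; case: eqP.
exists L'; split=> // A AN; rewrite L'E // M'E //.
by apply: contraNneq wq_out => <-.
Qed.

(** * Separating the center from its neighbors *)

Definition star_vertex_labels (G : sgraph) (v : G) (c : nat) (y : G) : nat :=
  if y == v then c else if adj v y then 3 else 1.

Definition ones_at (G : sgraph) (v : G) (L : {set G} -> nat) : {set G} :=
  [set y in nbhd v | L [set v; y] == 1].

(** With [s] the label of [uv], the weight of [u] is at most [3 + c + s + 2 * 4]
    and that of [v] at least [c + (s + 3) + 2 * 3 + 3]. *)
Lemma center_dominates (G : sgraph) (v u : G) (c : nat)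
    (L : {set G} -> nat) :
  regular 3 G -> labels3 L -> adj v u ->
  (forall x y, adj v x -> adj v y -> L [set x; y] = 1) ->
  #|ones_at v L| <= 1 ->
  label_weight (star_vertex_labels v c) L u
    < label_weight (star_vertex_labels v c) L v.
Proof.
move=> reg L3 vu L1 ones1.
have uv : adj u v by rewrite adj_sym.
rewrite (label_weightD1 _ _ vu) (label_weightD1 _ _ uv) [[set u; v]]setUC.
have gv : star_vertex_labels v c v = c by rewrite /star_vertex_labels eqxx.
have gN y : adj v y -> star_vertex_labels v c y = 3.
  move=> vy; rewrite /star_vertex_labels vy ifF //.
  by apply/negbTE; rewrite eq_sym adj_neq.
rewrite gv (gN u) //.
have le_u : \sum_(z in nbhd u :\ v) (L [set u; z] + star_vertex_labels v c z)
    <= 8.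
  have -> : 8 = #|nbhd u :\ v| * 4 by rewrite card_nbhdD1.
  rewrite -sum_nat_const.
  apply: leq_sum => z; rewrite !inE => /andP [zv _].
  case: (boolP (adj v z)) => vz; first by rewrite (L1 _ _ vu vz) (gN _ vz).
  rewrite /star_vertex_labels (negbTE zv) (negbTE vz).
  by have /andP [_ H] := L3 [set u; z]; rewrite addn1 ltnS.
have ge_v : 9 <=
    \sum_(z in nbhd v :\ u) (L [set v; z] + star_vertex_labels v c z).
  have le_ones : \sum_(z in nbhd v :\ u) (z \in ones_at v L) <= 1.
    apply: leq_trans ones1; rewrite -sum1_card big_mkcond [leqRHS]big_mkcond /=.
    by apply: leq_sum => z _; case: ifP => _; case: (z \in ones_at v L).
  have : \sum_(z in nbhd v :\ u) 5 <= \sum_(z in nbhd v :\ u)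
      ((L [set v; z] + star_vertex_labels v c z) + (z \in ones_at v L)).
    apply: leq_sum => z; rewrite !inE => /andP [_ vz]; rewrite gN // vz /=.
    by have := L3 [set v; z]; case: eqP; lia.
  by rewrite sum_nat_const card_nbhdD1 // big_split /=; lia.
lia.
Qed.

Definition rotate_at (G : sgraph) (v : G) (L : {set G} -> nat) (A : {set G}) :=
  if v \in A then (L A %% 3).+1 else L A.

(** A neighbor of [v] loses 1 from the label of [v] and gains 1 modulo 3 from
    the label of its edge to [v]. *)
Lemma rotate_at_residues (G : sgraph) (v y : G) (L : {set G} -> nat) (c : nat) :
  y != v ->
  label_weight (star_vertex_labels v c) (rotate_at v L) y
    = label_weight (star_vertex_labels v c.+1) L y %[mod 3].
Proof.
move=> yv.
have g_eq z : z != v ->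
    star_vertex_labels v c z = star_vertex_labels v c.+1 z.
  by rewrite /star_vertex_labels => /negbTE ->.
have L_eq z : z != v -> rotate_at v L [set y; z] = L [set y; z].
  move=> zv; rewrite /rotate_at ifF // !inE.
  by rewrite (eq_sym v y) (eq_sym v z) (negbTE yv) (negbTE zv).
case: (boolP (adj y v)) => ayv.
  rewrite !(label_weightD1 _ _ ayv) (g_eq y yv).
  rewrite (eq_bigr (fun z => L [set y; z] + star_vertex_labels v c.+1 z)).
    rewrite {1}/rotate_at {2 5}/star_vertex_labels !inE !eqxx orbT; lia.
  by move=> z; rewrite !inE => /andP [zv _]; rewrite L_eq ?g_eq.
congr (_ %% 3); rewrite /label_weight g_eq //; congr (_ + _).
apply: eq_bigr => z; rewrite inE => yz.
have zv : z != v by apply: contraNneq ayv => <-.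
by rewrite L_eq ?g_eq.
Qed.

Lemma nfsd_3_of_residues (G : sgraph) (v : G) (c : nat)
    (L : {set G} -> nat) :
  regular 3 G -> 1 <= c <= 3 -> labels3 L ->
  (forall x y, adj v x -> adj v y -> L [set x; y] = 1) ->
  residues_differ (star_vertex_labels v c) L (~: [set v]) ->
  #|ones_at v L| <= 1 ->
  nfsd_coloring 3 (coloring_of (star_vertex_labels v c) L).
Proof.
move=> reg c3 L3 L1 Ldiff ones1; split.
  case=> [x|a] /=; last exact: L3.
  by rewrite /star_vertex_labels; case: (x == v); case: (adj v x).
move=> x y xy; rewrite !weight_coloring_of.
case: (eqVneq x v) xy => [->|xv] xy.
  by move=> E; have := center_dominates c reg L3 xy L1 ones1; rewrite E ltnn.
case: (eqVneq y v) xy => [->|yv] xy.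
  move=> E; rewrite adj_sym in xy.
  by have := center_dominates c reg L3 xy L1 ones1; rewrite E ltnn.
by move=> E; apply: (Ldiff x y); rewrite ?inE // E.
Qed.

Lemma exists_nfsd_3_coloring (G : sgraph) :
  connected G -> regular 3 G ->
  exists f : G + edge G -> nat, nfsd_coloring 3 f.
Proof.
move=> conn reg; have [/card_gt0P [v _] _] := conn.
have [|L [L3 LE Ldiff]] := @greedy_residues G v (star_vertex_labels v 3)
  (fun=> 1) conn reg; first by [].
have L1 x y : adj v x -> adj v y -> L [set x; y] = 1.
  by move=> vx vy; apply: LE; apply/subsetP => z /set2P [] ->; rewrite inE.
case: (leqP #|ones_at v L| 1) => ones1.
  by exists (coloring_of (star_vertex_labels v 3) L); apply: nfsd_3_of_residues.
exists (coloring_of (star_vertex_labels v 2) (rotate_at v L)).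
apply: nfsd_3_of_residues => //.
- move=> A; rewrite /rotate_at; case: ifP => // _.
  by rewrite ltnS ltn_mod.
- move=> x y vx vy; rewrite /rotate_at ifF ?L1 // !inE.
  by rewrite (negbTE (adj_neq vx)) (negbTE (adj_neq vy)).
- move=> x y xv yv xy; rewrite !inE in xv yv.
  by rewrite !rotate_at_residues //; apply: Ldiff; rewrite ?inE.
(* Rotation turns exactly the labels 3 into 1, and at most one edge at [v] has
   label 3, because two of the three have label 1. *)
have dis : [disjoint ones_at v L & ones_at v (rotate_at v L)].
  rewrite -setI_eq0; apply/eqP/setP => y; rewrite !inE.
  apply/negP => /andP [/andP [_ /eqP E] /andP [_]].
  by rewrite /rotate_at !inE eqxx E.
have sub : ones_at v L :|: ones_at v (rotate_at v L) \subset nbhd v.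
  by apply/subsetP => y; rewrite !inE => /orP [] /andP [].
have := subset_leq_card sub; rewrite reg cardsU.
move: dis; rewrite -setI_eq0 => /eqP ->; rewrite cards0; lia.
Qed.

Lemma no_nfsd_1_coloring (G : sgraph) (d : nat) (x y : G)
    (f : G + edge G -> nat) :
  regular d G -> adj x y -> ~ nfsd_coloring 1 f.
Proof.
move=> reg xy [f1 fdiff]; apply: (fdiff x y xy).
have fE z : f z = 1 by apply/eqP; rewrite eqn_leq andbC f1.
have wE z : weight f z = 1 + d + d.
  have -> : weight f z = weight (coloring_of (fun=> 1) (fun=> 1)) z.
    by congr (_ + _ + _); rewrite ?fE //; apply: eq_bigr => a _; rewrite fE.
  rewrite weight_coloring_of /label_weight sum_nat_const reg.
  by rewrite muln2 -addnn addnA.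
by rewrite !wE.
Qed.

Theorem theorem7 (G : sgraph) (Gconn : connected G) (Greg : regular 3 G) :
  exists n : nat, is_fgndi G n /\ 2 <= n <= 3.
Proof.
have [/card_gt0P [v _] _] := Gconn.
have /card_gt0P [u] : 0 < #|nbhd v| by rewrite Greg.
rewrite inE => vu.
have lower k : 1 <= k ->
    (exists f : G + edge G -> nat, nfsd_coloring k f) -> 2 <= k.
  case: k => [|[|k]] // _ [f nf].
  by case: (no_nfsd_1_coloring Greg vu nf).
have [c2|nc2] := classic (exists f : G + edge G -> nat, nfsd_coloring 2 f).
  by exists 2; split.
exists 3; split=> //; split=> //; first exact: exists_nfsd_3_coloring.
move=> k k1 ck; have := lower k k1 ck; rewrite leq_eqVlt => /orP [/eqP E|//].
by move: ck; rewrite -E.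
Qed.
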